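(* There exists a maximal almost disjoint (m.a.d.) family of functions $\mathcal{A}\subseteq\omega^\omega$ such that $\mathcal{A}$ is not $s$-measurable, not $l$-measurable and not $m$-measurable (all three at the same time), and there is a subfamily $\mathcal{A}'\subseteq\mathcal{A}$ with $|\mathcal{A}'|\le\mathfrak{d}$ which is a dominating family in $\omega^\omega$.
   Context: $\omega^\omega$ is the Baire space. Two functions $f,g\in\omega^\omega$ are eventually different if $f\cap g$ is a finite subset of $\omega\times\omega$, i.e. $\{n: f(n)=g(n)\}$ is finite. A family $\mathcal{A}\subseteq\omega^\omega$ is almost disjoint (a.d.) if any two distinct members are eventually different; it is a m.a.d. family if it is maximal with respect to inclusion among almost disjoint families of functions in $\omega^\omega$. A family $\mathcal{D}\subseteq\omega^\omega$ is dominating if for every $x\in\omega^\omega$ there is $y\in\mathcal{D}$ with $x(n)\le y(n)$ for all but finitely many $n$; $\mathfrak{d}$ is the least cardinality of a dominating family. A tree $T\subseteq\omega^{<\omega}$ is a set of finite sequences closed under initial segments; $[T]=\{x\in\omega^\omega: (\forall n\in\omega)\ x\upharpoonright n\in T\}$. A node $t\in T$ is infinitely splitting if $\{n\in\omega: t^\frown n\in T\}$ is infinite. A tree $T$ is a Laver tree if there is a node $s\in T$ such that every node $t\in T$ with $s\subseteq t$ is infinitely splitting. A tree $T$ is a Miller tree if there is a node $s\in T$ such that for every node $t\in T$ with $s\subseteq t$ there is $t'\in T$ with $t\subseteq t'$ and $t'$ infinitely splitting. A set $A\subseteq\omega^\omega$ is: - $s$-measurable if for every nonempty perfect set $P\subseteq\omega^\omega$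 there is a nonempty perfect set $Q\subseteq P$ with $Q\subseteq A$ or $Q\cap A=\emptyset$; - $l$-measurable if for every Laver tree $T$ there is a Laver tree $S\subseteq T$ with $[S]\subseteq A$ or $[S]\cap A=\emptyset$; - $m$-measurable if for every Miller tree $T$ there is a Miller tree $S\subseteq T$ with $[S]\subseteq A$ or $[S]\cap A=\emptyset$. *)

(* Defs.v *)
From mathcomp Require Import all_boot all_order all_algebra.
From mathcomp Require Import all_classical.
From mathcomp Require Import reals topology.

Set Implicit Arguments.
Unset Strict Implicit.
Unset Printing Implicit Defensive.

Local Open Scope classical_set_scope.
Local Open Scope card_scope.

(* The library's canonical topology on [nat] is discrete. *)
Definition baire_space := prod_topology (fun _ : nat => nat).

Definition eventually_different (f g : baire_space) :=
  finite_set [set n | f n = g n].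

Definition almost_disjoint (A : set baire_space) :=
  forall f g, A f -> A g -> f <> g -> eventually_different f g.

Definition mad_family (A : set baire_space) :=
  almost_disjoint A /\
  forall B : set baire_space, almost_disjoint B -> A `<=` B -> B = A.

Definition dominating (D : set baire_space) :=
  forall x : baire_space,
    exists2 y : baire_space, D y & \forall n \near \oo, (x n <= y n)%N.

(* Cardinals are represented by sets of that cardinality: [D] is a dominating
   family of size the dominating number. *)
Definition has_dominating_number (D : set baire_space) :=
  dominating D /\ forall E, dominating E -> D #<= E.

Definition card_le_dominating_number (A : set baire_space) :=
  exists2 D, has_dominating_number D & A #<= D.

Definition tree (T : set (seq nat)) :=
  forall s t, prefix s t -> T t -> T s.

Definition body (T : set (seq nat)) : set baire_space :=
  [set x | forall n, T (mkseq x n)].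

Definition infinitely_splitting (T : set (seq nat)) (t : seq nat) :=
  infinite_set [set n | T (rcons t n)].

Definition laver_tree (T : set (seq nat)) :=
  tree T /\
  exists2 s, T s & forall t, T t -> prefix s t -> infinitely_splitting T t.

Definition miller_tree (T : set (seq nat)) :=
  tree T /\
  exists2 s, T s & forall t, T t -> prefix s t ->
    exists t', [/\ T t', prefix t t' & infinitely_splitting T t'].

Definition s_measurable (A : set baire_space) :=
  forall P : set baire_space, perfect_set P -> P !=set0 ->
    exists Q : set baire_space,
      [/\ perfect_set Q, Q !=set0, Q `<=` P & Q `<=` A \/ Q `&` A = set0].

Definition l_measurable (A : set baire_space) :=
  forall T, laver_tree T ->
    exists S, [/\ laver_tree S, S `<=` T
                & body S `<=` A \/ body S `&` A = set0].

Definition m_measurable (A : set baire_space) :=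
  forall T, miller_tree T ->
    exists S, [/\ miller_tree S, S `<=` T
                & body S `<=` A \/ body S `&` A = set0].

(* Main.v *)
From Stdlib Require Wellfounded.
Require Import Defs.
From mathcomp Require Import all_boot all_order all_algebra.
From mathcomp Require Import all_classical wochoice.
From mathcomp Require Import reals topology.

(** One almost disjoint perfect set serves as the witness against all three
    notions of measurability at once.  Send [x] to the function [code_fun false
    x] whose value at [n] codes the first [n + 1] values of [x].  Distinct
    [x] and [y] have different codes from some point on, so the image [P] of
    this map is almost disjoint.  It is also a perfect set, and it is the body
    of the Laver tree [code_tree].

    Split the Baire space by a Bernstein set [B], which meets the body of every
    perfect tree without containing it (lemma [exists_bernstein]).  Every
    nonempty perfect set contains the body of a perfect tree, and every Miller
    tree, hence every Laver tree, is a perfect tree.  So it is enough to find a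
    m.a.d. family [A] that agrees with [B] on [P]: then no nonempty perfect
    subset of [P], and no Laver or Miller subtree of [code_tree], decides [A].

    Keeping an element of [B] in [A] only requires starting the construction of
    [A] with it.  To keep a point [code_fun false x] outside [B] out of [A], its
    twin [code_fun true x] is put into [A] instead: the twin differs from the
    original exactly at the odd places, so the two are infinitely often equal
    and cannot both belong to [A], while it is eventually different from the
    codes and from the twins of the codes of all other [y].  The family [rep x]
    that picks the code or its twin according to [B] is therefore almost
    disjoint, and Zorn's lemma extends it to a m.a.d. family [A].

    Finally, a code bounds the entries of the coded sequence, so [x <= rep x]
    everywhere.  The image under [rep] of a dominating family of least
    cardinality is thus the required subfamily of [A]. *)

Local Open Scope classical_set_scope.
Local Open Scope card_scope.

(** * Choosing representatives and least cardinalities *)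

(** Choose the points by transfinite recursion along a well-order of [J] all of
    whose proper initial segments are too small to receive an injection from
    [J]: since [J] injects into [Q j], the earlier choices never exhaust it. *)
Lemma distinct_representatives (J X : Type) (Q : J -> set X) :
    (forall j, exists2 f : J -> X, injective f & forall k, Q j (f k)) ->
  exists2 a : J -> X, injective a & forall j, Q j (a j).
Proof.
move=> Qlarge.
suff [lt [wf_lt tot_lt small_lt]] : exists lt : J -> J -> Prop,
    [/\ well_founded lt, forall j k, [\/ lt j k, lt k j | j = k]
      & forall j (f : J -> J), injective f -> ~ forall k, lt (f k) j].
  have avoid j (b : forall k, lt k j -> X) :
      exists x, Q j x /\ forall k (kj : lt k j), x <> b k kj.
    apply: contrapT => nob; have [f injf Qf] := Qlarge j.
    have /choice[g gP] : forall i, exists k, exists kj : lt k j, f i = b k kj.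
      move=> i; apply: contrapT => nok; apply: nob; exists (f i); split=> //.
      by move=> k kj fE; apply: nok; exists k, kj.
    apply: (small_lt j g) => [i i' gii'|i]; last by have [] := gP i.
    have [p fi] := gP i; have [p' fi'] := gP i'; apply: injf.
    by move: p' fi'; rewrite fi -gii' => p' ->; congr b;
      apply: Prop_irrelevance.
  pose step j b := sval (cid (avoid j b)).
  pose a := Fix wf_lt (fun=> X) step.
  have aE j : a j = step j (fun k _ => a k).
    apply: Fix_eq => {}j b b' bb'; congr (step j _).
    by apply: functional_extensionality_dep => k;
      apply: functional_extensionality_dep.
  have aP j : Q j (a j) /\ forall k, lt k j -> a j <> a k.
    by rewrite aE /step; case: cid => /= x [].
  exists a => [j k ajk|j]; last by have [] := aP j.
  have [jk|kj|//] := tot_lt j k.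
    by have [_ /(_ j jk)] := aP k; rewrite ajk.
  by have [_ /(_ k kj)] := aP j.
(* An arbitrary well-order may be too long: cut it at the least [j] below which
   [J] injects, and pull the order back along that injection. *)
have [W Wwo] := well_ordering_principle {classic J}.
have leastW (A : set J) : A !=set0 -> exists2 m, A m & forall k, A k -> W m k.
  move=> [j Aj]; have [|m [[/asboolP Am mA] _]] := Wwo [pred k | `[< A k >]].
    by exists j; apply/asboolP.
  by exists m => // k Ak; apply/mA/asboolP.
have totW : total W by move=> j k; apply: (wo_chainW (withinW Wwo)).
have antiW : antisymmetric W.
  by move=> j k; apply: (wo_chain_antisymmetric (withinW Wwo)).
pose ltW (j k : J) := W j k /\ j <> k.
have wf_ltW : well_founded ltW.
  move=> j; apply: contrapT => nAj.
  have [|m nAm mmin] := leastW [set k | ~ Acc ltW k]; first by exists j.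
  apply: nAm; split=> k [km nkm]; apply: contrapT => nAk; apply: nkm.
  by apply: antiW; rewrite km mmin.
have [i injI smallI] : exists2 i : J -> J, injective i &
    forall j (f : J -> J), injective f -> ~ forall k, ltW (i (f k)) (i j).
  have [ex|nex] := pselect (exists j (f : J -> J),
      injective f /\ forall k, ltW (f k) j); last first.
    by exists id => // j f injf fj; apply: nex; exists j, f.
  have [j [i [injI ij]] jmin] := leastW _ ex.
  exists i => // k f injf fk; have [ikj nikj] := ij k; apply: nikj.
  apply: antiW; rewrite ikj jmin//.
  by exists (i \o f); split=> //; apply: inj_comp.
exists (fun j k => ltW (i j) (i k)); split; last exact: smallI.
- exact: Wellfounded.Inverse_Image.wf_inverse_image wf_ltW.
- move=> j k; have [jk|njk] := pselect (j = k); first by constructor 3.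
  have /orP[jk|kj] := totW (i j) (i k); [constructor 1|constructor 2].
    by split=> // /injI.
  by split=> // /injI/esym.
Qed.

(** Cardinals are well-founded.  Consider sets [R] of functions that select a
    point from each member of [F] and that are separated by their value at any
    single member.  Evaluation then injects a maximal such [R] into every
    member, and maximality forces it to exhaust one of them, which is therefore
    the smallest. *)
Lemma exists_min_card (X : Type) (F : set (set X)) : F !=set0 ->
  exists2 D, F D & forall E, F E -> D #<= E.
Proof.
move=> [E0 FE0].
pose P (R : set (set X -> X)) := (forall phi E, R phi -> F E -> E (phi E)) /\
  forall phi psi E, R phi -> R psi -> F E -> phi E = psi E -> phi = psi.
have [G GP totG|R [[Rsel Rinj] Rmax]] := @Zorn_bigcup _ P.
  split=> [phi E [R /GP[+ _]]|phi psi E [R GR Rphi] [S GS Spsi]]; first exact.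
  have [RS|SR] := totG _ _ GR GS.
    by have [_] := GP _ GS; apply=> //; apply: RS.
  by have [_] := GP _ GR; apply=> //; apply: SR.
have [D FD DR] : exists2 D, F D & D `<=` [set phi D | phi in R].
  apply: contrapT => nD.
  have missed E : F E -> exists x, E x /\ forall phi, R phi -> x <> phi E.
    move=> FE; apply: contrapT => nx; apply: nD; exists E => // x Ex.
    apply: contrapT => nR; apply: nx; exists x; split=> // phi Rphi xE.
    by apply: nR; exists phi.
  have [x0 _] := missed _ FE0.
  have /choice[chi chiP] E :
      exists x, F E -> E x /\ forall phi, R phi -> x <> phi E.
    by have [/missed[x]|nFE] := pselect (F E); [exists x|exists x0].
  apply: (Rmax (R `|` [set chi])).
    split=> [|/(_ chi (or_intror erefl)) Rchi]; first exact: subsetUl.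
    by have [_ /(_ _ Rchi)] := chiP _ FE0.
  split=> [phi E [Rphi|->] FE|phi psi E]; first exact: (Rsel phi E).
    by have [] := chiP _ FE.
  move=> [Rphi|->] [Rpsi|->] // FE eqE; first exact:
      (Rinj phi psi E Rphi Rpsi FE eqE).
    by have [_ /(_ _ Rphi)] := chiP _ FE; rewrite eqE.
  by have [_ /(_ _ Rpsi)] := chiP _ FE; rewrite eqE.
exists D => // E FE; apply: (card_le_trans (subset_card_le DR)).
apply: (card_le_trans (card_image_le _ _)).
have /injfunPex[f] : exists2 f : (set X -> X) -> X, set_fun R E f & set_inj R f.
  exists (@^~ E) => [phi Rphi|phi psi]; first exact: (Rsel phi E).
  by rewrite !inE => Rphi Rpsi; apply: (Rinj _ _ E).
exact: inj_card_le f.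
Qed.

Lemma infinite_of_inj (T : Type) (A : set T) (f : nat -> T) :
  injective f -> (forall n, A (f n)) -> infinite_set A.
Proof.
move=> f_inj Af; have fin : finite_set (range f) = finite_set [set: nat].
  exact: eq_finite_set (inj_card_eq (in2W f_inj)).
apply: (@sub_infinite_set _ (range f)) => [_ [n _ <-]//|].
by rewrite fin; apply: infinite_nat.
Qed.

(** * Initial segments and the topology of the Baire space *)

Lemma neq_exists (x y : nat -> nat) : x <> y -> exists n, x n <> y n.
Proof.
move=> nxy; apply: contrapT => nn; apply: nxy; apply/funext => n.
by apply: contrapT => nxyn; apply: nn; exists n.
Qed.

Lemma eq_mkseqP (x y : nat -> nat) n :
  mkseq x n = mkseq y n <-> forall i, (i < n)%N -> x i = y i.
Proof.
split=> [xy i ltin|xy]; last first.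
  by apply/eq_in_map => i; rewrite mem_iota => /andP[_]; apply: xy.
by rewrite -(nth_mkseq 0 x ltin) xy nth_mkseq.
Qed.

Lemma prefix_mkseqP (s : seq nat) (x : nat -> nat) n :
  prefix s (mkseq x n) <-> s = mkseq x (size s) /\ (size s <= n)%N.
Proof.
have takeE m : (m <= n)%N -> take m (mkseq x n) = mkseq x m.
  by move=> lemn; rewrite /mkseq -map_take take_iota (minn_idPl lemn).
rewrite prefixE; split=> [/eqP sE|[sE sn]]; last by rewrite takeE -?sE.
have sn : (size s <= n)%N by rewrite -sE size_take size_mkseq geq_minr.
by split=> //; rewrite -takeE// sE.
Qed.

Lemma prefix_mkseq (x : nat -> nat) m n :
  (m <= n)%N -> prefix (mkseq x m) (mkseq x n).
Proof. by move=> mn; apply/prefix_mkseqP; rewrite size_mkseq. Qed.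

Lemma prefix_total (s t u : seq nat) :
  prefix s u -> prefix t u -> prefix s t \/ prefix t s.
Proof.
have take_prefix m n : (m <= n)%N -> prefix (take m u) (take n u).
  by move=> mn; rewrite -(take_takel u mn) prefix_take.
rewrite ![prefix _ u]prefixE => /eqP <- /eqP <-.
have [st|/ltnW ts] := leqP (size s) (size t); [left|right]; exact: take_prefix.
Qed.

(** Since [nat] is discrete, convergence amounts to each coordinate being
    eventually constant. *)
Lemma baire_cvg (u : nat -> baire_space) (x : baire_space) :
  (forall i, \forall n \near \oo, u n i = x i) -> u @ \oo --> x.
Proof.
move=> ux; apply/cvg_sup => i; apply/cvg_image.
  by apply/seteqP; split=> // m _; exists (fun=> m).
move=> A /nbhs_singleton Axi; exists [set y : baire_space | A (y i)].
  by apply: filterS (ux i) => n /= ->.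
apply/seteqP; split=> [_ [y Ay <-]//|m Am]; exists (fun=> m) => //.
Qed.

Lemma nbhs_cylinder (x : baire_space) n :
  nbhs x [set y : baire_space | mkseq y n = mkseq x n].
Proof.
elim: n => [|n IHn]; first exact: filterS filterT.
have xn : nbhs x [set y : baire_space | y n = x n].
  exact: (@proj_continuous _ (fun=> nat) n x _ (discrete_set1 _)).
apply: filterS (filterI IHn xn) => y [/= yx yxn].
by rewrite !mkseqS yx yxn.
Qed.

(** * Perfect trees *)

Definition splitting (T : set (seq nat)) (t : seq nat) :=
  exists u v, [/\ T u /\ T v, prefix t u /\ prefix t v,
                  ~ prefix u v & ~ prefix v u].

(** Splitting is only required above a stem [s], so that Laver and Miller trees
    are special cases. *)
Definition perfect_tree (T : set (seq nat)) :=
  tree T /\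
  exists2 s, T s & forall t, T t -> prefix s t -> splitting T t.

Lemma laver_miller T : laver_tree T -> miller_tree T.
Proof.
move=> [treeT [s Ts sT]]; split=> //; exists s => // t Tt st.
by exists t; split; [|exact: prefix_refl|exact: sT].
Qed.

Lemma infinitely_splitting_splitting T t :
  infinitely_splitting T t -> splitting T t.
Proof.
move=> infT; have [m Tm] := infinite_setN0 infT.
have [n [Tn nm]] : [set n | T (rcons t n)] `\ m !=set0.
  by apply/infinite_setN0/infinite_setD => //; apply: finite_set1.
have prefix_eq i j : prefix (rcons t i) (rcons t j) -> i = j.
  rewrite prefixE size_rcons -(size_rcons t j) take_size eqseq_rcons eqxx.
  by move/eqP/esym.
exists (rcons t m), (rcons t n); split.
- by split.
- by rewrite !prefix_rcons.
- by move=> /prefix_eq/esym.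
- by move=> /prefix_eq.
Qed.

Lemma miller_perfect T : miller_tree T -> perfect_tree T.
Proof.
move=> [treeT [s Ts sT]]; split=> //; exists s => // t Tt st.
have [t' [Tt' tt']] := sT t Tt st.
move=> /infinitely_splitting_splitting[u [v [Tuv [tu tv] nuv nvu]]].
by exists u, v; split=> //; split; apply: prefix_trans; eassumption.
Qed.

(** The tree of initial segments of points of [P] branches since [P] has no
    isolated point, and its body is contained in [P] since [P] is closed. *)
Lemma perfect_set_tree (P : set baire_space) : perfect_set P -> P !=set0 ->
  exists2 T, perfect_tree T & body T `<=` P.
Proof.
move=> [clP limP] [x0 Px0].
exists [set s | exists2 x, P x & s = mkseq x (size s)].
  split=> [s t st [x Px tE]|].
    by exists x => //; move: st; rewrite tE => /prefix_mkseqP[].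
  exists [::] => [|t [x Px]]; first by exists x0.
  move: (size t) => k -> _.
  have [y [/eqP ynx Py yx]] :
      exists y, [/\ y != x, P y & mkseq y k = mkseq x k].
    by move: (Px); rewrite -[in X in X -> _]limP; apply; apply: nbhs_cylinder.
  have [n nyxn] := neq_exists _ _ ynx.
  pose N := maxn k n.+1.
  have incomp : mkseq x N <> mkseq y N.
    by move=> /eq_mkseqP/(_ n); rewrite leq_maxr => /(_ isT)/esym.
  exists (mkseq x N), (mkseq y N); split.
  - by split; [exists x|exists y]; rewrite ?size_mkseq.
  - by rewrite -{2}yx !prefix_mkseq// leq_maxl.
  - by move=> /prefix_mkseqP[+ _]; rewrite size_mkseq.
  - by move=> /prefix_mkseqP[+ _]; rewrite size_mkseq => /esym.
move=> x Tx.
have /choice[u uP] n : exists y : baire_space, P y /\ mkseq x n = mkseq y n.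
  by have [y Py yE] := Tx n; exists y; split=> //; rewrite yE size_mkseq.
have ux : u @ \oo --> x.
  apply: baire_cvg => i; exists i.+1 => // n /= lin.
  by have [_ /eq_mkseqP/(_ i lin)] := uP n.
apply: (closed_cvg _ clP _ _ ux); apply: nearW => n.
by have [] := uP n.
Qed.

(** Choosing two incompatible extensions of each node turns an infinite binary
    sequence into a branch; where two sequences first differ, their branches
    become incompatible. *)
Lemma perfect_tree_cantor T : perfect_tree T ->
  exists2 c : (nat -> bool) -> baire_space,
    injective c & forall z, body T (c z).
Proof.
move=> [treeT [s Ts sT]].
have /choice[e eP] t : exists e : bool -> seq nat, T t -> prefix s t ->
    [/\ forall b, T (e b), forall b, prefix t (e b),
        ~ prefix (e true) (e false) & ~ prefix (e false) (e true)].
  have [[Tt st]|nT] := pselect (T t /\ prefix s t); last first.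
    by exists (fun=> s) => Tt st; case: nT.
  have [u [v [[Tu Tv] [tu tv] nuv nvu]]] := sT t Tt st.
  by exists (fun b => if b then u else v); split=> // -[].
pose node z := fix node n := if n is m.+1 then e (node m) (z m) else s.
have nodeP z n : T (node z n) /\ prefix s (node z n).
  elim: n => [|n [Tn sn]] /=; first by rewrite prefix_refl.
  have [Te te _ _] := eP _ Tn sn; split; first exact: Te.
  exact: prefix_trans sn (te _).
have nodeS z n : prefix (node z n) (node z n.+1).
  by have [Tn sn] := nodeP z n; have [_ te _ _] := eP _ Tn sn; apply: te.
have size_nodeS z n : (size (node z n) < size (node z n.+1))%N.
  rewrite ltnNge; apply/negP => le.
  have [Tn sn] := nodeP z n; have [_ te ntf nft] := eP _ Tn sn.
  have eE : e (node z n) (z n) = node z n.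
    by move: (te (z n)); rewrite prefixE take_oversize => // /eqP.
  case: (z n) eE ntf nft => -> ntf nft; first exact: ntf (te false).
  exact: nft (te true).
have node_mono z m n : (m <= n)%N -> prefix (node z m) (node z n).
  elim: n => [|n IHn]; first by rewrite leqn0 => /eqP->; apply: prefix_refl.
  rewrite leq_eqVlt => /predU1P[->|/IHn mn]; first exact: prefix_refl.
  exact: prefix_trans mn (nodeS z n).
have size_node z n : (n <= size (node z n))%N.
  by elim: n => // n IHn; apply: leq_ltn_trans (size_nodeS z n).
pose c z : baire_space := fun i => nth 0%N (node z i.+1) i.
have nodeE z n : node z n = mkseq (c z) (size (node z n)).
  apply: (@eq_from_nth _ 0%N) => [|i ilt]; first by rewrite size_mkseq.
  rewrite nth_mkseq// /c.
  have nthE k l : (k <= l)%N -> (i < size (node z k))%N ->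
      nth 0%N (node z k) i = nth 0%N (node z l) i.
    move=> /(node_mono z)/prefixP[r ->] ik; by rewrite nth_cat ik.
  have [le|lt] := leqP n i.+1; first exact: nthE.
  by rewrite (nthE i.+1 n (ltnW lt))// size_node.
exists c => [z z' cE|z n].
  suff node_eq n : node z n = node z' n /\ z n = z' n.
    by apply/funext => n; have [] := node_eq n.
  have aux m : node z m = node z' m -> z m = z' m.
    move=> mE; have [Tm sm] := nodeP z m.
    have [_ _ ntf nft] := eP _ Tm sm.
    pose N := (size (node z m.+1) + size (node z' m.+1))%N.
    have znode : prefix (node z m.+1) (mkseq (c z) N).
      by rewrite nodeE prefix_mkseq// leq_addr.
    have z'node : prefix (node z' m.+1) (mkseq (c z) N).
      by rewrite nodeE -cE prefix_mkseq// leq_addl.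
    have := prefix_total _ _ _ znode z'node; rewrite /= -mE.
    by case: (z m) (z' m) => -[]// [].
  elim: n => [|n [nE zE]]; first by split=> //; apply: aux.
  have nE1 : node z n.+1 = node z' n.+1 by rewrite /= nE zE.
  by split=> //; apply: aux.
have [Tn _] := nodeP z n; apply: treeT Tn; rewrite nodeE.
exact: prefix_mkseq (size_node z n).
Qed.

(** * Bernstein sets and m.a.d. extensions *)

(** There are at most as many perfect trees as there are points in the body of
    any of them, so two points can be picked from each body, all of them
    distinct: the set of the first points is as required. *)
Lemma exists_bernstein : exists B : set baire_space,
  forall T, perfect_tree T ->
    (exists2 x, body T x & B x) /\ (exists2 x, body T x & ~ B x).
Proof.
have full : perfect_tree setT.
  apply: miller_perfect; apply: laver_miller.
  split=> //; exists [::] => // t _ _.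
  rewrite /infinitely_splitting (_ : [set _ | _] = setT).
    exact: infinite_nat.
  exact/seteqP.
(* Each tree is counted twice, the boolean telling whether the point picked for
   it goes into the Bernstein set. *)
pose enc (j : set (seq nat) * bool) : nat -> bool :=
  fun n => if n is m.+1 then `[< exists2 s, j.1 s & pickle s = m >] else j.2.
have enc_inj : injective enc.
  move=> [T b] [T' b'] encE; congr pair; last by have := congr1 (@^~ 0%N) encE.
  apply/seteqP; split=> s Ts.
    have : enc (T', b') (pickle s).+1 by rewrite -encE; apply/asboolP; exists s.
    by move=> /asboolP[s' Ts' /(pcan_inj pickleK) <-].
  have : enc (T, b) (pickle s).+1 by rewrite encE; apply/asboolP; exists s.
  by move=> /asboolP[s' Ts' /(pcan_inj pickleK) <-].
pose Q (j : set (seq nat) * bool) : set baire_space :=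
  [set x | perfect_tree j.1 -> body j.1 x].
have [|a a_inj aQ] := @distinct_representatives _ _ Q.
  move=> [T b].
  have [c cinj cP] : exists2 c : (nat -> bool) -> baire_space,
      injective c & forall z, Q (T, b) (c z).
    have [/perfect_tree_cantor[c cinj cT]|nT] := pselect (perfect_tree T).
      by exists c => // z _; apply: cT.
    by have [c cinj _] := perfect_tree_cantor _ full; exists c => // z /nT.
  by exists (c \o enc) => [|k]; [apply: inj_comp|apply: cP].
exists [set a (T, true) | T in setT] => T pT; split.
  by exists (a (T, true)); [exact: (aQ (T, true) pT)|exists T].
exists (a (T, false)); first exact: (aQ (T, false) pT).
by move=> [T' _ /a_inj].
Qed.

(** Zorn's lemma is applied to the sets [M] for which [A `|` M] is almost
    disjoint; this way the empty chain needs no special treatment. *)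
Lemma exists_mad_extension (A : set baire_space) : almost_disjoint A ->
  exists2 M, mad_family M & A `<=` M.
Proof.
move=> adA.
have [G GP totG|M [adM Mmax]] :=
    @Zorn_bigcup _ [set M | almost_disjoint (A `|` M)].
  move=> f g [Af|[M GM Mf]] [Ag|[N GN Ng]]; first exact: adA.
  - by apply: (GP _ GN); [left|right].
  - by apply: (GP _ GM); [right|left].
  - have [MN|NM] := totG _ _ GM GN.
      by apply: (GP _ GN); right => //; apply: MN.
    by apply: (GP _ GM); right => //; apply: NM.
exists (A `|` M); last exact: subsetUl.
split=> // B adB AMB; apply/seteqP; split=> //.
apply: contrapT => nBM; apply: (Mmax B).
  split=> [x Mx|BM]; first by apply: AMB; right.
  by apply: nBM => x /BM; right.
by rewrite /= (_ : A `|` B = B)//; apply/setUidPr => x Ax; apply: AMB; left.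
Qed.

(** * Coding a function by its initial segments *)

(** The code of the initial segment of length [n + 1] is doubled to leave room
    for a parity bit; [code_fun true x] is the twin of [code_fun false x], which
    sets this bit at the odd places only. *)
Definition code_fun (b : bool) (x : baire_space) : baire_space :=
  fun n => ((CodeSeq.code (mkseq x n.+1)).*2 + (b && odd n))%N.

(** The code of a sequence is larger than each of its entries. *)
Lemma code_fun_le b x n : (x n <= code_fun b x n)%N.
Proof.
have /allP/(_ (x n)) := CodeSeq.ltn_code (mkseq x n.+1).
rewrite /code_fun mkseqS mem_rcons mem_head => /(_ isT)/ltnW xle.
by rewrite -addnn -addnA (leq_trans xle)// leq_addr.
Qed.

Lemma code_fun_eq b b' x y n :
  code_fun b x n = code_fun b' y n -> mkseq x n.+1 = mkseq y n.+1.
Proof.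
move=> /(congr1 half); rewrite /code_fun ![(_.*2 + _)%N]addnC !half_bit_double.
by move=> /(can_inj CodeSeq.codeK).
Qed.

Lemma code_fun_ed b b' x y : x <> y ->
  eventually_different (code_fun b x) (code_fun b' y).
Proof.
move=> nxy; have [n xyn] := neq_exists _ _ nxy.
apply: (sub_finite_set _ (finite_II n)) => m /code_fun_eq/eq_mkseqP xym /=.
by rewrite ltnNge; apply/negP => nm; apply/xyn/xym.
Qed.

Lemma code_fun_not_ed x :
  ~ eventually_different (code_fun false x) (code_fun true x).
Proof.
apply: (infinite_of_inj _ _ double) => [|n /=]; first exact: double_inj.
by rewrite /code_fun odd_double.
Qed.

Lemma code_fun_neq x : code_fun false x <> code_fun true x.
Proof.
move=> /(congr1 (@^~ 1%N)); rewrite /code_fun /= addn0 addn1.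
by move/eqP; rewrite eqn_leq ltnn andbF.
Qed.

Lemma code_fun_inj b : injective (code_fun b).
Proof.
move=> x y xy; apply/funext => n.
by have /code_fun_eq/eq_mkseqP := congr1 (@^~ n) xy; apply.
Qed.

Definition code_tree :=
  [set s | exists x, s = mkseq (code_fun false x) (size s)].

(** If all initial segments of [y] are initial segments of codes, of functions
    that vary with the length, then these functions agree on longer and longer
    initial segments, and their diagonal is coded by [y]. *)
Lemma body_code_tree : body code_tree = range (code_fun false).
Proof.
apply/seteqP; split=> [y Ty|_ [x _ <-] n]; last by exists x; rewrite size_mkseq.
have /choice[u uP] n : exists x, mkseq y n.+1 = mkseq (code_fun false x) n.+1.
  by have [x ->] := Ty n.+1; exists x; rewrite !size_mkseq.
exists (fun n => u n n) => //; apply/funext => n.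
have /eq_mkseqP un := uP n; rewrite un// /code_fun; congr (_.*2 + _)%N.
congr CodeSeq.code.
apply/eq_mkseqP => i lin.
have /eq_mkseqP ui := uP i.
by have /code_fun_eq/eq_mkseqP -> // :=
  etrans (esym (ui i (ltnSn i))) (un i lin).
Qed.

Definition update (x : baire_space) n m : baire_space :=
  fun i => if i == n then m else x i.

Lemma code_fun_update x n m :
  mkseq (code_fun false (update x n m)) n = mkseq (code_fun false x) n.
Proof.
apply/eq_mkseqP => i lin; rewrite /code_fun; congr (_.*2 + _)%N.
congr CodeSeq.code.
apply/eq_mkseqP => j lji; rewrite /update; case: eqP => // jn.
by move: lji; rewrite jn ltnNge lin.
Qed.

Lemma update_at x n m : update x n m n = m.
Proof. by rewrite /update eqxx. Qed.

(** The value at [n] of the code involves the values of [x] up to [n] included,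
    so changing [x n] alone gives infinitely many successors at level [n]. *)
Lemma code_tree_laver : laver_tree code_tree.
Proof.
split=> [s t st [x tE]|].
  by exists x; move: st; rewrite tE => /prefix_mkseqP[].
exists [::] => [|t [x tE] _]; first by exists point.
pose succ m := code_fun false (update x (size t) m) (size t).
apply: (infinite_of_inj _ _ succ) => [m m'|].
  by move=> /code_fun_eq/eq_mkseqP/(_ (size t) (ltnSn _)); rewrite !update_at.
move=> m /=; exists (update x (size t) m).
by rewrite size_rcons mkseqS code_fun_update -tE.
Qed.

Lemma range_code_fun_perfect : perfect_set (range (code_fun false)).
Proof.
have clR : closed (range (code_fun false)).
  rewrite -body_code_tree => y cly n.
  have [z [Tz zy]] := cly _ (nbhs_cylinder y n).
  by rewrite -[mkseq y n]zy; apply: Tz.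
split=> //; apply/seteqP; split.
  exact: subset_trans (@subset_limit_point _ _) clR.
move=> _ [x _ <-] U Ux.
pose u (n : nat) := code_fun false (update x n (x n).+1).
have ux : u @ \oo --> code_fun false x.
  apply: baire_cvg => i; exists i.+1 => // n /= lin.
  have /eq_mkseqP := code_fun_update x n (x n).+1; exact.
have [n Un] : exists n, U (u n).
  by have [n _ uU] := ux U Ux; exists n; apply: (uU n) => /=.
exists (u n); split=> //.
apply/eqP => /code_fun_inj /(congr1 (@^~ n)); rewrite update_at.
exact/nesym/n_Sn.
Qed.

(** * The family *)

Theorem theorem2p6 :
  exists A : set baire_space,
    [/\ mad_family A,
        ~ s_measurable A,
        ~ l_measurable A,
        ~ m_measurable A
      & exists A' : set baire_space,
          [/\ A' `<=` A, card_le_dominating_number A' & dominating A']].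
Proof.
have [B Bbern] := exists_bernstein.
(* A code stays in the family when it belongs to [B], and is replaced by its
   twin otherwise. *)
pose rep x := code_fun `[< ~ B (code_fun false x) >] x.
have [|A [adA maxA] repA] := exists_mad_extension (range rep).
  move=> _ _ [x _ <-] [y _ <-] nxy; apply: code_fun_ed => xy.
  by apply: nxy; rewrite xy.
have AB x : A (code_fun false x) <-> B (code_fun false x).
  have Arep : A (rep x) by apply: repA; exists x.
  have [Bx|nBx] := pselect (B (code_fun false x)).
    by split=> // _; move: Arep; rewrite /rep asboolF//; apply.
  split=> // Ax; move: Arep; rewrite /rep asboolT// => Ax'.
  by case: (code_fun_not_ed x); apply: adA => //; apply: code_fun_neq.
have undecided S : perfect_tree S -> body S `<=` range (code_fun false) ->
    ~ (body S `<=` A \/ body S `&` A = set0).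
  move=> /Bbern[[y Sy By] [z Sz nBz]] Srange [SA|SA0].
    have [x _ xz] := Srange z Sz; apply: nBz; rewrite -xz; apply/AB.
    by rewrite xz; apply: SA.
  have [x _ xy] := Srange y Sy; suff : set0 y by [].
  by rewrite -SA0; split=> //; rewrite -xy; apply/AB; rewrite xy.
exists A; split=> //.
- move=> /(_ _ range_code_fun_perfect) [|Q [pQ Q0 QR decQ]].
    by exists (code_fun false point); exists point.
  have [T pT TQ] := perfect_set_tree _ pQ Q0.
  apply: (undecided T pT (subset_trans TQ QR)).
  case: decQ => [QA|QA0]; [left|right]; first exact: subset_trans TQ QA.
  by apply/seteqP; split=> // y [/TQ Qy Ay]; rewrite -QA0.
- move=> /(_ _ code_tree_laver)[S [LS ST decS]].
  apply: (undecided S) decS; first exact/miller_perfect/laver_miller.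
  by rewrite -body_code_tree => y Sy n; apply/ST/Sy.
- move=> /(_ _ (laver_miller _ code_tree_laver))[S [MS ST decS]].
  apply: (undecided S) decS; first exact/miller_perfect.
  by rewrite -body_code_tree => y Sy n; apply/ST/Sy.
have [|D domD Dmin] := exists_min_card _ dominating.
  by exists setT => x; exists x => //; apply: nearW.
exists (rep @` D); split.
- by move=> _ [x _ <-]; apply: repA; exists x.
- exists D; last exact: card_image_le.
  by split.
- move=> x; have [y Dy xy] := domD x; exists (rep y); first by exists y.
  by apply: filterS xy => n xyn; apply: leq_trans xyn (code_fun_le _ _ _).
Qed.
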